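(* For every finite multiset of formulas $\Gamma$ and every formula $\varphi$: if $\Gamma\models_{\mathbf{K}_3}\varphi$, then BSC-K$_3\vdash\Gamma\Rightarrow\varphi\mid\ \Rightarrow$ (the bisequent whose 1-sequent is $\Gamma\Rightarrow\varphi$ and whose 2-sequent is empty on both sides).
   Context: Formulas are built from propositional atoms with connectives $\neg,\wedge,\vee,\rightarrow$. A $\mathbf{K}_3$-valuation is a homomorphism $h$ from formulas to $\{0,u,1\}$ (ordered $0<u<1$) with: $h(\neg\varphi)=1,u,0$ when $h(\varphi)=0,u,1$; $h(\varphi\wedge\psi)=\min(h(\varphi),h(\psi))$; $h(\varphi\vee\psi)=\max(h(\varphi),h(\psi))$; $h(\varphi\rightarrow\psi)=\max(h(\neg\varphi),h(\psi))$. $\Gamma\models_{\mathbf{K}_3}\varphi$ means: for every valuation $h$, if $h(\gamma)=1$ for all $\gamma\in\Gamma$ then $h(\varphi)=1$. A sequent is $\Gamma\Rightarrow\Delta$ with $\Gamma,\Delta$ finite multisets of formulas; a bisequent is an ordered pair of sequents $\Gamma\Rightarrow\Delta\mid\Pi\Rightarrow\Sigma$. A bisequent is axiomatic iff some formula occurs in both $\Gamma$ and $\Sigma$, or in both $\Gamma$ and $\Delta$, or in both $\Pi$ and $\Sigma$. BSC-K$_3\vdash B$ means there is a finite tree of bisequents with root $B$, all of whose leaves are axiomatic, and in which every non-leaf node is the conclusion of an instance of one of the following rules whose premisses are exactly its children ($S$ denotes an arbitrary sequent): $(\neg\Rightarrow\mid)$: from $\Gamma\Rightarrow\Delta\mid\Pi\Rightarrow\Sigma,\varphi$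 infer $\neg\varphi,\Gamma\Rightarrow\Delta\mid\Pi\Rightarrow\Sigma$. $(\Rightarrow\neg\mid)$: from $\Gamma\Rightarrow\Delta\mid\varphi,\Pi\Rightarrow\Sigma$ infer $\Gamma\Rightarrow\Delta,\neg\varphi\mid\Pi\Rightarrow\Sigma$. $(\mid\neg\Rightarrow)$: from $\Gamma\Rightarrow\Delta,\varphi\mid\Pi\Rightarrow\Sigma$ infer $\Gamma\Rightarrow\Delta\mid\neg\varphi,\Pi\Rightarrow\Sigma$. $(\mid\Rightarrow\neg)$: from $\varphi,\Gamma\Rightarrow\Delta\mid\Pi\Rightarrow\Sigma$ infer $\Gamma\Rightarrow\Delta\mid\Pi\Rightarrow\Sigma,\neg\varphi$. $(\wedge\Rightarrow\mid)$: from $\varphi,\psi,\Gamma\Rightarrow\Delta\mid S$ infer $\varphi\wedge\psi,\Gamma\Rightarrow\Delta\mid S$. $(\Rightarrow\wedge\mid)$: from $\Gamma\Rightarrow\Delta,\varphi\mid S$ and $\Gamma\Rightarrow\Delta,\psi\mid S$ infer $\Gamma\Rightarrow\Delta,\varphi\wedge\psi\mid S$. $(\mid\wedge\Rightarrow)$: from $S\mid\varphi,\psi,\Gamma\Rightarrow\Delta$ infer $S\mid\varphi\wedge\psi,\Gamma\Rightarrow\Delta$. $(\mid\Rightarrow\wedge)$: from $S\mid\Gamma\Rightarrow\Delta,\varphi$ and $S\mid\Gamma\Rightarrow\Delta,\psi$ infer $S\mid\Gamma\Rightarrow\Delta,\varphi\wedge\psi$. $(\Rightarrow\vee\mid)$: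 from $\Gamma\Rightarrow\Delta,\varphi,\psi\mid S$ infer $\Gamma\Rightarrow\Delta,\varphi\vee\psi\mid S$. $(\vee\Rightarrow\mid)$: from $\varphi,\Gamma\Rightarrow\Delta\mid S$ and $\psi,\Gamma\Rightarrow\Delta\mid S$ infer $\varphi\vee\psi,\Gamma\Rightarrow\Delta\mid S$. $(\mid\Rightarrow\vee)$: from $S\mid\Gamma\Rightarrow\Delta,\varphi,\psi$ infer $S\mid\Gamma\Rightarrow\Delta,\varphi\vee\psi$. $(\mid\vee\Rightarrow)$: from $S\mid\varphi,\Gamma\Rightarrow\Delta$ and $S\mid\psi,\Gamma\Rightarrow\Delta$ infer $S\mid\varphi\vee\psi,\Gamma\Rightarrow\Delta$. $(\Rightarrow\rightarrow\mid)$: from $\Gamma\Rightarrow\Delta,\psi\mid\varphi,\Pi\Rightarrow\Sigma$ infer $\Gamma\Rightarrow\Delta,\varphi\rightarrow\psi\mid\Pi\Rightarrow\Sigma$. $(\mid\Rightarrow\rightarrow)$: from $\varphi,\Gamma\Rightarrow\Delta\mid\Pi\Rightarrow\Sigma,\psi$ infer $\Gamma\Rightarrow\Delta\mid\Pi\Rightarrow\Sigma,\varphi\rightarrow\psi$. $(\rightarrow\Rightarrow\mid)$: from $\Gamma\Rightarrow\Delta\mid\Pi\Rightarrow\Sigma,\varphi$ and $\psi,\Gamma\Rightarrow\Delta\mid\Pi\Rightarrow\Sigma$ infer $\varphi\rightarrow\psi,\Gamma\Rightarrow\Delta\mid\Pi\Rightarrow\Sigma$. $(\mid\rightarrow\Rightarrow)$: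 from $\Gamma\Rightarrow\Delta,\varphi\mid\Pi\Rightarrow\Sigma$ and $\Gamma\Rightarrow\Delta\mid\psi,\Pi\Rightarrow\Sigma$ infer $\Gamma\Rightarrow\Delta\mid\varphi\rightarrow\psi,\Pi\Rightarrow\Sigma$. *)

(* Defs.v *)
From HB Require Import structures.
From mathcomp Require Import all_boot all_order.
From mathcomp Require Import finmap multiset.

Set Implicit Arguments.
Unset Strict Implicit.
Unset Printing Implicit Defensive.

Local Open Scope mset_scope.

(* The propositional language over an arbitrary type of atoms; a choiceType is
   what finite multisets of formulas require of their elements. *)
Inductive form (A : Type) : Type :=
| Atom of A
| Neg of form A
| And of form A & form A
| Or of form A & form A
| Imp of form A & form A.

Fixpoint form_to_tree (A : Type) (f : form A) : GenTree.tree A :=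
  match f with
  | Atom a => GenTree.Leaf a
  | Neg f => GenTree.Node 0 [:: form_to_tree f]
  | And f g => GenTree.Node 1 [:: form_to_tree f; form_to_tree g]
  | Or f g => GenTree.Node 2 [:: form_to_tree f; form_to_tree g]
  | Imp f g => GenTree.Node 3 [:: form_to_tree f; form_to_tree g]
  end.

Fixpoint tree_to_form (A : Type) (t : GenTree.tree A) : option (form A) :=
  match t with
  | GenTree.Leaf a => Some (Atom a)
  | GenTree.Node 0 [:: t] => omap (@Neg A) (tree_to_form t)
  | GenTree.Node n.+1 [:: t; t'] =>
      match tree_to_form t, tree_to_form t' with
      | Some f, Some g =>
          match n with
          | 0 => Some (And f g)
          | 1 => Some (Or f g)
          | _ => Some (Imp f g)
          end
      | _, _ => None
      end
  | _ => None
  end.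

Lemma form_to_treeK (A : Type) : pcancel (@form_to_tree A) (@tree_to_form A).
Proof. by elim=> //= [f ->|f -> g ->|f -> g ->|f -> g ->]. Qed.

HB.instance Definition _ (A : choiceType) :=
  Choice.copy (form A) (pcan_type (@form_to_treeK A)).

Inductive K3 : Type := V0 | Vu | V1.

Definition K3_rank (x : K3) : nat :=
  match x with V0 => 0 | Vu => 1 | V1 => 2 end.

Definition K3_unrank (n : nat) : K3 :=
  match n with 0 => V0 | 1 => Vu | _ => V1 end.

Lemma K3_rankK : cancel K3_rank K3_unrank.
Proof. by case. Qed.

HB.instance Definition _ := Choice.copy K3 (can_type K3_rankK).

Definition K3_le (x y : K3) : bool := K3_rank x <= K3_rank y.
Definition K3_lt (x y : K3) : bool := K3_rank x < K3_rank y.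
Definition K3_min (x y : K3) : K3 := if K3_lt x y then x else y.
Definition K3_max (x y : K3) : K3 := if K3_lt x y then y else x.

Lemma K3_lt_def x y : K3_lt x y = (y != x) && K3_le x y.
Proof. by case: x; case: y. Qed.

Lemma K3_le_anti : antisymmetric K3_le.
Proof. by case; case. Qed.

Lemma K3_le_trans : transitive K3_le.
Proof. by move=> y x z; exact: leq_trans. Qed.

Lemma K3_le_total : total K3_le.
Proof. by move=> x y; exact: leq_total. Qed.

HB.instance Definition _ :=
  @Order.isOrder.Build (Order.Disp tt tt) K3 K3_le K3_lt K3_min K3_max
    K3_lt_def (fun x y => erefl) (fun x y => erefl)
    K3_le_anti K3_le_trans K3_le_total.

Definition K3_neg (x : K3) : K3 :=
  match x with V0 => V1 | Vu => Vu | V1 => V0 end.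

Record K3_valuation (A : Type) (h : form A -> K3) : Prop := K3Valuation {
  val_neg : forall f, h (Neg f) = K3_neg (h f);
  val_and : forall f g, h (And f g) = Order.min (h f) (h g);
  val_or : forall f g, h (Or f g) = Order.max (h f) (h g);
  val_imp : forall f g, h (Imp f g) = Order.max (h (Neg f)) (h g)
}.

Definition K3_entails (A : choiceType) (G : {mset form A}) (f : form A) : Prop :=
  forall h : form A -> K3, K3_valuation h ->
    (forall g, g \in G -> h g = V1) -> h f = V1.

Record sequent (A : choiceType) : Type :=
  Sequent { ant : {mset form A}; suc : {mset form A} }.

Record bisequent (A : choiceType) : Type :=
  Bisequent { fst_seq : sequent A; snd_seq : sequent A }.

Notation "G ⇒ D" := (Sequent G D) (at level 71, no associativity).
Notation "S ∣ T" := (Bisequent S T) (at level 72, no associativity).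

Definition axiomatic (A : choiceType) (B : bisequent A) : Prop :=
  let: (G ⇒ D) ∣ (P ⇒ E) := B in
  exists f : form A,
    [\/ f \in G /\ f \in E, f \in G /\ f \in D | f \in P /\ f \in E].

Reserved Notation "⊢ B" (at level 73).

(* [a +` G] adds one occurrence of [a] to the multiset [G]. Constructor names:
   1/2 is the component of the bisequent, L/R the side of the sequent that
   contains the principal formula. *)
Inductive BSC_K3 (A : choiceType) : bisequent A -> Prop :=
| BSC_ax (B : bisequent A) : axiomatic B -> ⊢ B
| BSC_neg1L G D P E f :
    ⊢ G ⇒ D ∣ P ⇒ f +` E ->
    ⊢ Neg f +` G ⇒ D ∣ P ⇒ E
| BSC_neg1R G D P E f :
    ⊢ G ⇒ D ∣ f +` P ⇒ E ->
    ⊢ G ⇒ Neg f +` D ∣ P ⇒ E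
| BSC_neg2L G D P E f :
    ⊢ G ⇒ f +` D ∣ P ⇒ E ->
    ⊢ G ⇒ D ∣ Neg f +` P ⇒ E
| BSC_neg2R G D P E f :
    ⊢ f +` G ⇒ D ∣ P ⇒ E ->
    ⊢ G ⇒ D ∣ P ⇒ Neg f +` E
| BSC_and1L G D T f g :
    ⊢ f +` (g +` G) ⇒ D ∣ T ->
    ⊢ And f g +` G ⇒ D ∣ T
| BSC_and1R G D T f g :
    ⊢ G ⇒ f +` D ∣ T ->
    ⊢ G ⇒ g +` D ∣ T ->
    ⊢ G ⇒ And f g +` D ∣ T
| BSC_and2L T G D f g :
    ⊢ T ∣ f +` (g +` G) ⇒ D ->
    ⊢ T ∣ And f g +` G ⇒ D
| BSC_and2R T G D f g :
    ⊢ T ∣ G ⇒ f +` D ->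
    ⊢ T ∣ G ⇒ g +` D ->
    ⊢ T ∣ G ⇒ And f g +` D
| BSC_or1R G D T f g :
    ⊢ G ⇒ f +` (g +` D) ∣ T ->
    ⊢ G ⇒ Or f g +` D ∣ T
| BSC_or1L G D T f g :
    ⊢ f +` G ⇒ D ∣ T ->
    ⊢ g +` G ⇒ D ∣ T ->
    ⊢ Or f g +` G ⇒ D ∣ T
| BSC_or2R T G D f g :
    ⊢ T ∣ G ⇒ f +` (g +` D) ->
    ⊢ T ∣ G ⇒ Or f g +` D
| BSC_or2L T G D f g :
    ⊢ T ∣ f +` G ⇒ D ->
    ⊢ T ∣ g +` G ⇒ D ->
    ⊢ T ∣ Or f g +` G ⇒ D
| BSC_imp1R G D P E f g :
    ⊢ G ⇒ g +` D ∣ f +` P ⇒ E ->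
    ⊢ G ⇒ Imp f g +` D ∣ P ⇒ E
| BSC_imp2R G D P E f g :
    ⊢ f +` G ⇒ D ∣ P ⇒ g +` E ->
    ⊢ G ⇒ D ∣ P ⇒ Imp f g +` E
| BSC_imp1L G D P E f g :
    ⊢ G ⇒ D ∣ P ⇒ f +` E ->
    ⊢ g +` G ⇒ D ∣ P ⇒ E ->
    ⊢ Imp f g +` G ⇒ D ∣ P ⇒ E
| BSC_imp2L G D P E f g :
    ⊢ G ⇒ f +` D ∣ P ⇒ E ->
    ⊢ G ⇒ D ∣ g +` P ⇒ E ->
    ⊢ G ⇒ D ∣ Imp f g +` P ⇒ E
where "⊢ B" := (BSC_K3 B).

(* Main.v *)
(* Call a bisequent refuted by a valuation when its four components take,
   in order, values = 1, <> 1, <> 0 and = 0. Every rule is invertible for this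
   reading: a valuation refuting a premise refutes the conclusion. Applying the
   rules backwards decreases the total size of the formulas, so by induction
   every bisequent is derivable or refuted. An atomic bisequent that is not
   axiomatic is refuted by giving value 1 to the atoms of the first antecedent,
   0 to those of the second succedent, and u to the others. *)

Require Import Defs.
From mathcomp Require Import all_boot all_order.
From mathcomp Require Import finmap multiset zify.

Set Implicit Arguments.
Unset Strict Implicit.

Local Open Scope mset_scope.

Lemma perm_mset1D (K : choiceType) (a : K) (M : {mset K}) :
  perm_eq (a +` M) (a :: M).
Proof.
apply/allP => x _; apply/eqP.
have -> : count_mem x (a :: M) = (a == x) + count_mem x M by [].
by rewrite !count_mem_mset mset1DE eq_sym.
Qed.

Lemma all_mset1D (K : choiceType) (p : pred K) (a : K) (M : {mset K}) :
  all p (a +` M) = p a && all p M.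
Proof. by rewrite (perm_all _ (perm_mset1D a M)). Qed.

(** Used with [is_atom] to expose a compound formula as the principal formula of a rule. *)
Lemma allPn_mset (K : choiceType) (p : pred K) (M : {mset K}) :
  ~~ all p M -> exists a M', ~~ p a /\ M = a +` M'.
Proof. by case/allPn => a aM pa; exists a, (M `\ a); rewrite msetB1K. Qed.

Fixpoint form_size (A : Type) (f : form A) : nat :=
  match f with
  | Atom _ => 1
  | Neg f => (form_size f).+1
  | And f g | Or f g | Imp f g => (form_size f + form_size g).+1
  end.

Definition is_atom (A : Type) (f : form A) : bool :=
  if f is Atom _ then true else false.

Fixpoint eval (A : Type) (v : A -> K3) (f : form A) : K3 :=
  match f with
  | Atom a => v a
  | Neg f => K3_neg (eval v f)
  | And f g => Order.min (eval v f) (eval v g)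
  | Or f g => Order.max (eval v f) (eval v g)
  | Imp f g => Order.max (K3_neg (eval v f)) (eval v g)
  end.

Lemma eval_valuation (A : Type) (v : A -> K3) : K3_valuation (eval v).
Proof. by []. Qed.

Definition mset_size (A : choiceType) (M : {mset form A}) : nat :=
  sumn [seq form_size f | f <- M].

Lemma mset_size1D (A : choiceType) (f : form A) (M : {mset form A}) :
  mset_size (f +` M) = form_size f + mset_size M.
Proof. exact: perm_sumn (perm_map _ (perm_mset1D f M)). Qed.

Definition bisequent_size (A : choiceType) (B : bisequent A) : nat :=
  let: (G ⇒ D) ∣ (P ⇒ E) := B in
  mset_size G + mset_size D + mset_size P + mset_size E.

Definition refutes (A : choiceType) (v : A -> K3) (B : bisequent A) : bool :=
  let: (G ⇒ D) ∣ (P ⇒ E) := B in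
  [&& all (fun f => eval v f == V1) G, all (fun f => eval v f != V1) D,
      all (fun f => eval v f != V0) P & all (fun f => eval v f == V0) E].

Definition decided (A : choiceType) (B : bisequent A) : Prop :=
  (⊢ B) \/ exists v, refutes v B.

Lemma decided_rule1 (A : choiceType) (B1 B : bisequent A) :
  ((⊢ B1) -> ⊢ B) -> (forall v, refutes v B1 -> refutes v B) ->
  decided B1 -> decided B.
Proof.
by move=> dB rB [/dB|[v /rB]]; [left | right; exists v].
Qed.

Lemma decided_rule2 (A : choiceType) (B1 B2 B : bisequent A) :
  ((⊢ B1) -> (⊢ B2) -> ⊢ B) ->
  (forall v, refutes v B1 || refutes v B2 -> refutes v B) ->
  decided B1 -> decided B2 -> decided B.
Proof.
move=> dB rB [dB1|[v rB1]]; last by right; exists v; rewrite rB ?rB1.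
by case=> [dB2|[v rB2]]; [left; apply: dB | right; exists v; rewrite rB ?rB2 ?orbT].
Qed.

Lemma atomic_decided (A : choiceType) (G D P E : {mset form A}) :
  all (@is_atom A) G -> all (@is_atom A) D ->
  all (@is_atom A) P -> all (@is_atom A) E ->
  decided (G ⇒ D ∣ P ⇒ E).
Proof.
move=> /allP aG /allP aD /allP aP /allP aE.
(* The three tests follow the clauses of [axiomatic]; when all fail, [G] is disjoint from [E] and
   [D], and [P] from [E]. *)
case: (boolP (has (mem E) G)) => [/hasP[f fG fE]|/hasPn GE].
  by left; apply: BSC_ax; exists f; apply: Or31.
case: (boolP (has (mem D) G)) => [/hasP[f fG fD]|/hasPn GD].
  by left; apply: BSC_ax; exists f; apply: Or32.
case: (boolP (has (mem E) P)) => [/hasP[f fP fE]|/hasPn PE].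
  by left; apply: BSC_ax; exists f; apply: Or33.
right; exists (fun a => if Atom a \in G then V1
                        else if Atom a \in E then V0 else Vu).
apply/and4P; split; apply/allP => f.
- by move=> fG; have := aG f fG; case: f fG => //= a -> _.
- move=> fD; have := aD f fD; case: f fD => //= a aD' _.
  case: ifPn => [/GD|_]; first by rewrite /= aD'.
  by case: ifP.
- move=> fP; have := aP f fP; have := PE f fP; case: f fP => //= a _ aE' _.
  by rewrite (negbTE aE'); case: ifP.
(* Membership in [G] is tested first, so value 0 on [E] relies on [G] and [E] being disjoint. *)
- move=> fE; have := aE f fE; case: f fE => //= a aE' _.
  by case: ifPn => [/GE|_]; rewrite /= aE'.
Qed.

Ltac size_decreases :=
  rewrite /bisequent_size !mset_size1D /=; lia.

(** Once the active formulas are split off, refutation depends only on their truth values and on one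
    boolean per context, so a finite table settles it. *)
Ltac premise_refuted :=
  let v := fresh "v" in
  move=> v; rewrite /refutes !all_mset1D /=;
  repeat match goal with
  | |- context [eval v ?f] => case: (eval v f)
  | |- context [all ?p ?M] => case: (all p M)
  end; by [].

(** Unifying with the rule [r] determines the premise that [eapply] leaves open. *)
Ltac apply_rule1 IH r :=
  eapply decided_rule1;
  [exact: r | premise_refuted | apply: IH; size_decreases].

Ltac apply_rule2 IH r :=
  eapply decided_rule2;
  [exact: r | premise_refuted | apply: IH; size_decreases
  | apply: IH; size_decreases].

Lemma bisequent_decided (A : choiceType) (B : bisequent A) : decided B.
Proof.
have [n] := ubnP (bisequent_size B); elim: n B => // n IH [[G D] [P E]] szB.
case: (boolP (all (@is_atom A) G)) => [aG|/allPn_mset].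
case: (boolP (all (@is_atom A) D)) => [aD|/allPn_mset].
case: (boolP (all (@is_atom A) P)) => [aP|/allPn_mset].
case: (boolP (all (@is_atom A) E)) => [aE|/allPn_mset].
exact: atomic_decided.
(* The compound formula lies in [E], [P], [D] or [G], in this order; its main connective selects the
   rule. *)
all: case=> -[a|f|f g|f g|f g] [M [//= _ defM]]; move: szB; rewrite {}defM;
  rewrite /bisequent_size mset_size1D /= => szB.
- apply_rule1 IH BSC_neg2R.
- apply_rule2 IH BSC_and2R.
- apply_rule1 IH BSC_or2R.
- apply_rule1 IH BSC_imp2R.
- apply_rule1 IH BSC_neg2L.
- apply_rule1 IH BSC_and2L.
- apply_rule2 IH BSC_or2L.
- apply_rule2 IH BSC_imp2L.
- apply_rule1 IH BSC_neg1R.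
- apply_rule2 IH BSC_and1R.
- apply_rule1 IH BSC_or1R.
- apply_rule1 IH BSC_imp1R.
- apply_rule1 IH BSC_neg1L.
- apply_rule1 IH BSC_and1L.
- apply_rule2 IH BSC_or1L.
- apply_rule2 IH BSC_imp1L.
Qed.

Theorem mainTheorem3 (A : choiceType) (G : {mset form A}) (f : form A) :
  K3_entails G f -> ⊢ G ⇒ [mset f] ∣ mset0 ⇒ mset0.
Proof.
move=> Gf; case: (bisequent_decided (G ⇒ [mset f] ∣ mset0 ⇒ mset0)) => // -[v].
(* A refuting [v] gives value 1 to all of [G] but not to [f], against the entailment. *)
case/and4P=> /allP vG /allP/(_ f (mset11 f)) /eqP vf _ _; case: vf.
by apply: Gf (eval_valuation v) _ => g /vG/eqP.
Qed.
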